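(* Let $\mathfrak g$ be the free $3$-step nilpotent real Lie algebra on two generators $X,Y$, let $G$ be the corresponding simply connected Lie group (identified with $\mathfrak g$ as in the context), and let $S=\{X,Y\}$. Let $\Sigma$ be the set of $\mathbb R$-words of the form $X^{s_1}Y^{t_1}X^{s_2}Y^{t_2}\cdots X^{s_m}Y^{t_m}$ (with $m\ge 1$ arbitrary) such that all $s_i,t_j$ are nonnegative real numbers and $\sum_i s_i=\sum_j t_j=1$. Then for every $N$ there exists an $\mathbb R$-word $w\in\Sigma$ such that there is no $\mathbb R$-word $w'$ over $S$ satisfying $\ell(w')\le 2=\ell(w)$, $|w'|=|w|$ and $\ell'(w')\le N$.
   Context: The free $3$-step nilpotent real Lie algebra $\mathfrak g$ on $X,Y$ has dimension $5$, with basis $X,\ Y,\ \tfrac12[X,Y],\ \tfrac1{12}[X,[X,Y]],\ \tfrac1{12}[Y,[Y,X]]$. The corresponding simply connected Lie group $G$ is identified with $\mathfrak g$ as a set (exponential and logarithm are the identity map), with group law $a\cdot b=a+b+\tfrac12[a,b]+\tfrac1{12}[a,[a,b]]+\tfrac1{12}[b,[b,a]]$. Let $S_{\mathbb R}=\{x^t : x\in S,\ t\in\mathbb R\}$. An $\mathbb R$-word over $S$ is a finite word $w=x_1^{t_1}x_2^{t_2}\cdots x_k^{t_k}$ over the alphabet $S_{\mathbb R}$ (with $x_j\in S$, $t_j\in\mathbb R$). Its length is $\ell(w)=\sum_{j=1}^k|t_j|$ and its coarse length is $\ell'(w)=k$. The element $|w|\in G$ is the result of evaluating $w$ in $G$,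 i.e. the product in $G$ of the elements $|x_j^{t_j}|=t_jx_j$ (scalar multiplication in $\mathfrak g$), taken in order. *)

(* Defs.v *)
From HB Require Import structures.
From mathcomp Require Import all_boot all_order all_algebra.
From mathcomp Require Import boolp classical_sets reals.

Set Implicit Arguments.
Unset Strict Implicit.
Unset Printing Implicit Defensive.

Import Order.TTheory GRing.Theory Num.Theory.

Local Open Scope classical_set_scope.
Local Open Scope ring_scope.

HB.mixin Record Lmodule_isLie (K : fieldType) V of GRing.Lmodule K V := {
  brac : V -> V -> V;
  brac_linearl : forall b, linear (brac^~ b);
  brac_linearr : forall a, linear (brac a);
  bracxx : forall a, brac a a = 0;
  jacobi : forall a b c,
    brac a (brac b c) + brac b (brac c a) + brac c (brac a b) = 0
}.

#[short(type="lieAlgType")]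
HB.structure Definition LieAlg (K : fieldType) :=
  { V of GRing.Lmodule K V & Lmodule_isLie K V }.

Reserved Notation "⟦ a , b ⟧" (at level 0, a, b at level 99).
Notation "⟦ a , b ⟧" := (brac a b) : ring_scope.

Section Lie.
Variable K : fieldType.

(* [lcs g n] is the term usually numbered n + 1 in the lower central series of
   g: it starts at [lcs g 0] = g, and [lcs g n.+1] is the linear span of the
   brackets ⟦a, b⟧ with b in [lcs g n]. Scalar coefficients are not needed in
   the span because they can be absorbed in a. *)
Fixpoint lcs (g : lieAlgType K) (n : nat) {struct n} : set g :=
  if n is n'.+1 then
    [set v | exists s : seq (g * g),
       (forall p, p \in s -> @lcs g n' p.2) /\ v = \sum_(p <- s) ⟦p.1, p.2⟧]
  else setT.

Arguments lcs : clear implicits.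

(* Nilpotent of class at most c. *)
Definition nilpotent_step (c : nat) (g : lieAlgType K) : Prop :=
  lcs g c = [set 0].

Definition lie_hom (g h : lieAlgType K) (f : g -> h) : Prop :=
  linear f /\ forall a b, f ⟦a, b⟧ = ⟦f a, f b⟧.

(* g is the free c-step nilpotent Lie algebra on the two generators X and Y,
   i.e. the free object on (X, Y) among Lie algebras nilpotent of class at
   most c. *)
Definition free_nilpotent2 (c : nat) (g : lieAlgType K) (X Y : g) : Prop :=
  nilpotent_step c g /\
  forall (h : lieAlgType K) (x y : h), nilpotent_step c h ->
    exists2 f : g -> h, [/\ lie_hom f, f X = x & f Y = y] &
      forall f' : g -> h, [/\ lie_hom f', f' X = x & f' Y = y] -> f' =1 f.

End Lie.

Arguments lcs {K} g n.

Section Words.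
Variables (R : realType) (g : lieAlgType R).

(* The group law that the Baker-Campbell-Hausdorff formula puts on a Lie
   algebra nilpotent of class at most 3; its neutral element is 0. *)
Definition gmul (a b : g) : g :=
  a + b + (2%:R^-1 : R) *: ⟦a, b⟧ + (12%:R^-1 : R) *: ⟦a, ⟦a, b⟧⟧
        + (12%:R^-1 : R) *: ⟦b, ⟦b, a⟧⟧.

(* The pair (x, t) stands for the formal letter x^t. *)
Definition rword := seq (g * R).

Definition rword_over (S : set g) (w : rword) : Prop :=
  forall p, p \in w -> S p.1.

Definition rlength (w : rword) : R := \sum_(p <- w) `|p.2|.

Definition coarse_length (w : rword) : nat := size w.

Definition reval (w : rword) : g := \big[gmul/0]_(p <- w) (p.2 *: p.1).

(* The pairs in st are the successive exponents (s_i, t_i). *)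
Definition Sigma (X Y : g) : set rword :=
  [set w | exists st : seq (R * R),
    [/\ (0 < size st)%N,
        forall p, p \in st -> 0 <= p.1 /\ 0 <= p.2,
        \sum_(p <- st) p.1 = 1,
        \sum_(p <- st) p.2 = 1 &
        w = flatten [seq [:: (X, p.1); (Y, p.2)] | p <- st]]].

End Words.

(* Main.v *)
(** Read a word in X, Y with nonnegative exponents as a monotone staircase from
    (0,0) to (1,1). The integral of (y - x)^2 dx along the staircase depends only
    on the element of G that the word represents; it even factors through a
    4-dimensional quotient of g. Each horizontal step of length s contributes at
    least s^3/12, so a staircase with N steps has integral at least of order
    N^-2, while the regular staircase with 2m steps has integral 1/(3m^2), which
    is smaller once m is large compared with N. Every competitor is a staircase: a
    word of length at most 2 whose exponents sum to 2 has no negative exponent. *)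
From HB Require Import structures.
Require Import Defs.
From mathcomp Require Import all_boot all_order all_algebra.
From mathcomp Require Import boolp classical_sets reals.
From mathcomp Require Import ring lra.

Import Order.TTheory GRing.Theory Num.Theory.
Local Open Scope classical_set_scope.
Local Open Scope ring_scope.

(** * Homomorphisms and the evaluation of words *)

Section LieHom.
Variables (R : realType) (g h : lieAlgType R) (f : g -> h).
Hypothesis fP : lie_hom f.

Lemma lie_hom0 : f 0 = 0.
Proof. by have [lf _] := fP; have := lf (-1) 0 0; rewrite !scaleN1r !addNr. Qed.

Lemma lie_homD a b : f (a + b) = f a + f b.
Proof. by have [lf _] := fP; have := lf 1 a b; rewrite !scale1r. Qed.

Lemma lie_homZ k a : f (k *: a) = k *: f a.
Proof. by have [lf _] := fP; have := lf k a 0; rewrite lie_hom0 !addr0. Qed.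

Lemma lie_hom_gmul a b : f (gmul a b) = gmul (f a) (f b).
Proof. by have [_ fb] := fP; rewrite /gmul !(lie_homD, lie_homZ, fb). Qed.

Lemma lie_hom_reval (w : rword g) :
  f (reval w) = reval [seq (f p.1, p.2) | p <- w].
Proof.
rewrite /reval big_map (big_morph f lie_hom_gmul lie_hom0).
by apply: eq_bigr => p _; rewrite lie_homZ.
Qed.

End LieHom.

Lemma reval_cons (R : realType) (g : lieAlgType R) (p : g * R) (w : rword g) :
  reval (p :: w) = gmul (p.2 *: p.1) (reval w).
Proof. by rewrite /reval big_cons. Qed.

(** The terms [|F q| - F q] are nonnegative with sum at most 0, so each of them vanishes. *)
Lemma norm_sum_le_ge0 {R : realDomainType} {T : eqType} (F : T -> R) (w : seq T) :
  \sum_(p <- w) `|F p| <= \sum_(p <- w) F p -> forall p, p \in w -> 0 <= F p.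
Proof.
move=> le_sum p pw.
have ge0 q : 0 <= `|F q| - F q by rewrite subr_ge0 ler_norm.
have /eqP : \sum_(q <- w) (`|F q| - F q) = 0.
  by apply/le_anti; rewrite sumr_ge0 // sumrB subr_le0 le_sum.
rewrite psumr_eq0 // => /allP/(_ p pw)/=.
by rewrite subr_eq0 => /eqP <-.
Qed.

(** * The Engel algebra, a 4-dimensional nilpotent Lie algebra *)

Local Notation engel K := (K^o * K^o * K^o * K^o)%type.

Section Engel.
Context {K : fieldType}.
Implicit Types u v w : engel K.

(* Coordinates over the basis A, B, [A, B], [B, [A, B]] of the Engel algebra,
   where [A, [A, B]] = 0. With A = X + Y and B = Y, the coordinates of a path
   over A and B are x and z = y - x. *)
Definition Engel (a b c d : K) : engel K := (a, b, c, d).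
Definition coordA v : K := v.1.1.1.
Definition coordB v : K := v.1.1.2.
Definition coordAB v : K := v.1.2.
Definition coordBAB v : K := v.2.

Lemma engelP v w :
  [/\ coordA v = coordA w, coordB v = coordB w,
      coordAB v = coordAB w & coordBAB v = coordBAB w] -> v = w.
Proof.
case: v w => [[[? ?] ?] ?] [[[? ?] ?] ?].
by rewrite /coordA /coordB /coordAB /coordBAB /= => -[-> -> -> ->].
Qed.

Lemma coord_add v w :
  (coordA (v + w) = coordA v + coordA w) *
  (coordB (v + w) = coordB v + coordB w) *
  (coordAB (v + w) = coordAB v + coordAB w) *
  (coordBAB (v + w) = coordBAB v + coordBAB w).
Proof. by []. Qed.

Lemma coord_scale k v :
  (coordA (k *: v) = k * coordA v) * (coordB (k *: v) = k * coordB v) *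
  (coordAB (k *: v) = k * coordAB v) * (coordBAB (k *: v) = k * coordBAB v).
Proof. by []. Qed.

Lemma coord_zero :
  (coordA 0 = 0) * (coordB 0 = 0) * (coordAB 0 = 0) * (coordBAB 0 = 0).
Proof. by []. Qed.

Lemma coord_Engel a b c d :
  (coordA (Engel a b c d) = a) * (coordB (Engel a b c d) = b) *
  (coordAB (Engel a b c d) = c) * (coordBAB (Engel a b c d) = d).
Proof. by []. Qed.

Definition coordE := (coord_add, coord_scale, coord_zero, coord_Engel).

Definition engel_brac v w : engel K :=
  Engel 0 0 (coordA v * coordB w - coordB v * coordA w)
            (coordB v * coordAB w - coordAB v * coordB w).

Lemma engel_linearl w : linear (engel_brac^~ w).
Proof. by move=> k u v; apply: engelP; rewrite !coordE; split; ring. Qed.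

Lemma engel_linearr v : linear (engel_brac v).
Proof. by move=> k u w; apply: engelP; rewrite !coordE; split; ring. Qed.

Lemma engel_bracxx v : engel_brac v v = 0.
Proof. by apply: engelP; rewrite !coordE; split; ring. Qed.

Lemma engel_jacobi u v w :
  engel_brac u (engel_brac v w) + engel_brac v (engel_brac w u)
  + engel_brac w (engel_brac u v) = 0.
Proof. by apply: engelP; rewrite !coordE; split; ring. Qed.

HB.instance Definition _ := Lmodule_isLie.Build K (engel K)
  engel_linearl engel_linearr engel_bracxx engel_jacobi.

Lemma engel_bracE v w : ⟦v, w⟧ = engel_brac v w.
Proof. by []. Qed.

Lemma engel_nilpotent : nilpotent_step 3 (engel K).
Proof.
(* An additive coordinate that vanishes on brackets vanishes on their sums. Successive terms of the
   series thus lose A and B, then [A, B], then [B, [A, B]]. *)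
have sum0 (q : engel K -> K) (s : seq (engel K * engel K)) :
    q 0 = 0 -> {morph q : v w / v + w} ->
    (forall p, p \in s -> q ⟦p.1, p.2⟧ = 0) -> q (\sum_(p <- s) ⟦p.1, p.2⟧) = 0.
  by move=> q0 qD qs; rewrite (big_morph q qD q0) big_seq big1.
have lcs1 v : lcs (engel K) 1 v -> coordA v = 0 /\ coordB v = 0.
  by move=> [s [_ ->]]; split; [apply: (sum0 coordA)|apply: (sum0 coordB)].
have lcs2 v : lcs (engel K) 2 v ->
    [/\ coordA v = 0, coordB v = 0 & coordAB v = 0].
  move=> [s [sP ->]]; split;
    [exact: (sum0 coordA)|exact: (sum0 coordB)|apply: (sum0 coordAB) => //].
  by move=> p /sP/lcs1[pa pb]; rewrite engel_bracE coordE pa pb !mulr0 subr0.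
apply/seteqP; split=> [v [s [sP ->]]|_ ->].
  apply: engelP; split; [exact: (sum0 coordA)|exact: (sum0 coordB)| |].
    apply: (sum0 coordAB) => // p /sP/lcs2[pa pb _].
    by rewrite engel_bracE coordE pa pb !mulr0 subr0.
  apply: (sum0 coordBAB) => // p /sP/lcs2[_ pb pab].
  by rewrite engel_bracE coordE pb pab !mulr0 subr0.
by exists [::]; rewrite big_nil.
Qed.

(** X = A - B: a horizontal step lowers y - x. *)
Definition engelX : engel K := Engel 1 (-1) 0 0.
Definition engelY : engel K := Engel 0 1 0 0.

End Engel.

(** * The integral of (y - x)^2 dx as a function on the Engel group *)

Section Invariant.
Context {R : realType}.
Implicit Types (v w : engel R) (p : engel R * R) (l : rword (engel R)).

Lemma coordA_gmul v w : coordA (gmul v w) = coordA v + coordA w.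
Proof. by rewrite /gmul !(engel_bracE, coordE); ring. Qed.

Lemma coordB_gmul v w : coordB (gmul v w) = coordB v + coordB w.
Proof. by rewrite /gmul !(engel_bracE, coordE); ring. Qed.

(* The integral of (u + y - x)^2 dx along any path representing v, where u is
   the initial offset: the integrals of y - x and of (y - x)^2 over dx are
   [ab/2 - c] and [ab^2/3 - bc - 2d] in the coordinates a, b, c, d of v. *)
Definition sqint (u : R) v : R :=
  u ^+ 2 * coordA v + u * (coordA v * coordB v - 2 * coordAB v)
  + (coordA v * coordB v ^+ 2 / 3 - coordB v * coordAB v - 2 * coordBAB v).

(** Integrals add under concatenation; the second path starts at the offset where the first one
    ends. *)
Lemma sqint_gmul u v w :
  sqint u (gmul v w) = sqint u v + sqint (u + coordB v) w.
Proof. by rewrite /sqint /gmul !(engel_bracE, coordE); field. Qed.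

Lemma sqint0 u : sqint u 0 = 0.
Proof. by rewrite /sqint !coordE; field. Qed.

(** The offset falls linearly from u to u - s; its square integrates to a mean part plus a variance
    part, and the latter does not depend on u. *)
Lemma sqintX u s :
  sqint u (s *: engelX) = s * (u - s / 2) ^+ 2 + s ^+ 3 / 12.
Proof. by rewrite /sqint !coordE; field. Qed.

Lemma sqintY u t : sqint u (t *: engelY) = 0.
Proof. by rewrite /sqint !coordE; field. Qed.

(** In path coordinates, 2x + (y - x) = x + y. *)
Lemma sum_exponents l : rword_over [set engelX; engelY] l ->
  \sum_(p <- l) p.2 = 2 * coordA (reval l) + coordB (reval l).
Proof.
elim: l => [|p l IHl] lXY.
  by rewrite /reval !big_nil !coordE; ring.
rewrite reval_cons big_cons coordA_gmul coordB_gmul IHl => [|q ql]; last first.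
  by apply: lXY; rewrite inE ql orbT.
by have [->|->] := lXY p (mem_head _ _); rewrite !coordE; ring.
Qed.

(* [3c^2 s - 2c^3] is the tangent line of [s^3] at [c]. *)
Lemma sqint_reval_ge c u l : 0 <= c -> rword_over [set engelX; engelY] l ->
  (forall p, p \in l -> 0 <= p.2) ->
  (3 * c ^+ 2 * coordA (reval l) - 2 * c ^+ 3 * (size l)%:R) / 12
    <= sqint u (reval l).
Proof.
move=> c0; elim: l u => [|p l IHl] u lXY l0.
  by rewrite /reval big_nil sqint0 !coordE !mulr0 subr0 mul0r.
rewrite reval_cons coordA_gmul sqint_gmul /= -natr1.
have := IHl (u + coordB (p.2 *: p.1)).
have q_in q : q \in l -> q \in p :: l by rewrite inE => ->; rewrite orbT.
move=> /(_ (fun q ql => lXY q (q_in q ql)) (fun q ql => l0 q (q_in q ql))).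
have p0 : 0 <= p.2 by apply: l0; rewrite mem_head.
have c3 : 0 <= c ^+ 3 by rewrite exprn_ge0.
have [->|->] := lXY p (mem_head _ _); last first.
  (* A letter Y leaves the integral unchanged and lowers the bound by c^3/6. *)
  by rewrite sqintY !coordE; lra.
rewrite sqintX !coordE mulr1.
have sq : 0 <= p.2 * (u - p.2 / 2) ^+ 2 by rewrite mulr_ge0 ?sqr_ge0.
have : 0 <= (p.2 - c) ^+ 2 * (p.2 + 2 * c).
  by rewrite mulr_ge0 ?sqr_ge0 // addr_ge0 // mulr_ge0.
have -> : (p.2 - c) ^+ 2 * (p.2 + 2 * c)
          = p.2 ^+ 3 - 3 * c ^+ 2 * p.2 + 2 * c ^+ 3 by ring.
by lra.
Qed.

End Invariant.

(** * Regular staircases *)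

Definition staircase {T R : Type} (X Y : T) (n : nat) (s : R) : seq (T * R) :=
  flatten [seq [:: (X, p.1); (Y, p.2)] | p <- nseq n (s, s)].

Lemma map_staircase {T T' R : Type} (f : T -> T') (X Y : T) (n : nat) (s : R) :
  [seq (f p.1, p.2) | p <- staircase X Y n s] = staircase (f X) (f Y) n s.
Proof. by elim: n => //= n; rewrite /staircase /= => ->. Qed.

Lemma rlength_staircase {R : realType} {g : lieAlgType R} (X Y : g) n (s : R) :
  0 <= s -> rlength (staircase X Y n s) = 2 * (n%:R * s).
Proof.
move=> s0; elim: n => [|n IHn]; first by rewrite /rlength big_nil mul0r mulr0.
move: IHn; rewrite /rlength !big_cons /= => ->.
by rewrite ger0_norm // -natr1; ring.
Qed.

(** Each block X^s Y^s returns to the diagonal, so all blocks contribute the same s^3/3. *)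
Lemma reval_staircase {R : realType} n (s : R) :
  let v := reval (staircase (engelX : engel R) engelY n s) in
  [/\ coordA v = n%:R * s, coordB v = 0 & sqint 0 v = n%:R * (s ^+ 3 / 3)].
Proof.
elim: n => [|n [IHa IHb IHi]] /=.
  by rewrite /reval big_nil sqint0 !coordE !mul0r.
rewrite !reval_cons -/(staircase _ _ n s).
rewrite !coordA_gmul !coordB_gmul !sqint_gmul sqintX sqintY !coordE /=.
have -> : 0 + s * -1 + s * 1 = 0 :> R by ring.
by rewrite IHa IHb IHi -natr1; split; field.
Qed.

Theorem corollary3 (R : realType) (g : lieAlgType R) (X Y : g)
    (hfree : free_nilpotent2 3 X Y) (N : nat) :
  exists w : rword g,
    [/\ Sigma X Y w,
        rlength w = 2%:R &
        ~ exists w' : rword g,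
            [/\ rword_over [set X; Y] w',
                rlength w' <= 2%:R,
                reval w' = reval w &
                (coarse_length w' <= N)%N]].
Proof.
have [f [fP fX fY] _] := hfree.2 _ engelX engelY (@engel_nilpotent R).
(* The tangent point [c] is about the mean step of a competitor; [N.+1] keeps it defined for N = 0.
   The factor 3 makes the regular steps short enough for the final contradiction. *)
pose c : R := N.+1%:R^-1; pose m := (3 * N.+1)%N; pose s : R := c / 3.
have n_gt0 : 0 < N.+1%:R :> R by rewrite ltr0n.
have c_gt0 : 0 < c by rewrite invr_gt0.
have s_ge0 : 0 <= s by rewrite divr_ge0 ?ltW.
have nc : N.+1%:R * c = 1 by rewrite mulfV ?gt_eqF.
have ms : m%:R * s = 1 by rewrite natrM -[RHS]nc /s; field.
exists (staircase X Y m s); split.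
- exists (nseq m (s, s)); split=> //.
  + by move=> p; rewrite mem_nseq => /andP[_ /eqP->].
  + by rewrite big_nseq iter_addr_0 -mulr_natl.
  + by rewrite big_nseq iter_addr_0 -mulr_natl.
- by rewrite rlength_staircase // ms mulr1.
move=> [w' [w'XY len_w' eval_w' size_w']].
pose l : rword (engel R) := [seq (f p.1, p.2) | p <- w'].
have lXY : rword_over [set engelX; engelY] l.
  by move=> _ /mapP[p /w'XY[] -> ->]; [left|right].
have [la lb li] := reval_staircase m s.
have eval_l : reval l = reval (staircase engelX engelY m s).
  by rewrite -lie_hom_reval // eval_w' lie_hom_reval // map_staircase fX fY.
rewrite -eval_l ms in la lb li.
have l_ge0 : forall p, p \in l -> 0 <= p.2.
  (* The common endpoint forces the exponents to sum to 2, the maximal length allowed. *)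
  apply: (norm_sum_le_ge0 (fun p : engel R * R => p.2)).
  by rewrite sum_exponents // la lb mulr1 addr0 big_map.
have size_l : (size l)%:R * c <= 1.
  rewrite -[leRHS]nc ler_pM2r // ler_nat size_map; exact: leq_trans size_w' (leqnSn N).
have := sqint_reval_ge c 0 l (ltW c_gt0) lXY l_ge0.
rewrite la li.
have -> : m%:R * (s ^+ 3 / 3) = c ^+ 2 / 27.
  have -> : m%:R * (s ^+ 3 / 3) = m%:R * s * (s ^+ 2 / 3) by ring.
  by rewrite ms /s; field.
(* This raises the lower bound to (3c^2 - 2c^2)/12 = c^2/12, which exceeds c^2/27. *)
have : c ^+ 2 * ((size l)%:R * c) <= c ^+ 2 * 1.
  by rewrite ler_wpM2l ?sqr_ge0.
have -> : c ^+ 2 * ((size l)%:R * c) = c ^+ 3 * (size l)%:R by ring.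
have : 0 < c ^+ 2 by rewrite exprn_gt0.
by lra.
Qed.
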